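(* Let $n\geq 2$ and $\mathbf{q},\mathbf{p}\in(\Bbbk^\times)^n$. Then $B_n(\mathbf{q})\cong B_n(\mathbf{p})$ if and only if there exist $\alpha_0,\dots,\alpha_{n-1}\in\Bbbk^\times$ and $0\le k<n$ such that $p_i=\frac{\alpha_{i+k+1}}{\alpha_{i+k}}q_{i+k}$ for all $0\le i<n$ (indices modulo $n$).
   Context: $\Bbbk$ is an algebraically closed field of characteristic zero. Paths are written left to right ($xy$ means $x$ then $y$). For $n\ge2$ and $\mathbf{q}=(q_0,\dots,q_{n-1})\in(\Bbbk^\times)^n$, $B_n(\mathbf{q})=\Bbbk Q/(b_ia_i-q_ia_ib_{i+1},\ i=0,\dots,n-1)$, where $Q$ has vertices $e_0,\dots,e_{n-1}$, arrows $a_i:e_i\to e_{i+1}$ and a loop $b_i$ at $e_i$ for each $i$, indices modulo $n$. *)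

(* Defs.v *)
From mathcomp Require Import all_boot all_algebra.
Set Implicit Arguments.
Unset Strict Implicit.
Unset Printing Implicit Defensive.
Import GRing.Theory.
Local Open Scope ring_scope.

(* The quiver Q of B_n(q): vertices 'I_n; arrows (false,i) = a_i : e_i -> e_{i+1}
   and (true,i) = b_i : loop at e_i.  Paths are written left to right:
   a path is (start vertex, list of arrows in order of traversal). *)
Section PathAlgebra.
Variable K : fieldType.
Variable n : nat.

Definition arrow := (bool * 'I_n)%type.
Definition arr_a (i : 'I_n) : arrow := (false, i).
Definition arr_b (i : 'I_n) : arrow := (true, i).
Definition src (x : arrow) : 'I_n := x.2.
Definition tgt (x : arrow) : 'I_n := if x.1 then x.2 else ordS x.2.

Definition path := ('I_n * seq arrow)%type.

Fixpoint valid_from (v : 'I_n) (s : seq arrow) : bool :=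
  if s is x :: s' then (src x == v) && valid_from (tgt x) s' else true.
Definition valid (p : path) : bool := valid_from p.1 p.2.
Definition endv (v : 'I_n) (s : seq arrow) : 'I_n := last v (map tgt s).

(* Elements of the path algebra kQ are finitely supported K-valued
   functions on (valid) paths; the operations are defined on all functions. *)
Definition elt := path -> K.
Definition fin_supp (f : elt) : Prop :=
  exists s : seq path, forall r, f r != 0 -> (r \in s) && valid r.

Definition eadd (f g : elt) : elt := fun r => f r + g r.
Definition eopp (f : elt) : elt := fun r => - f r.
Definition escale (c : K) (f : elt) : elt := fun r => c * f r.
(* product = concatenation of paths (left to right), extended bilinearly *)
Definition emul (f g : elt) : elt := fun r =>
  if valid r then
    \sum_(i < (size r.2).+1) f (r.1, take i r.2) * g (endv r.1 (take i r.2), drop i r.2)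
  else 0.
Definition delta (p : path) : elt := fun r => if r == p then 1 else 0.
Definition eone : elt := fun r => if r.2 == [::] then 1 else 0.

Definition brel (q : 'I_n -> K) (i : 'I_n) : elt :=
  eadd (delta (i, [:: arr_b i; arr_a i]))
       (eopp (escale (q i) (delta (i, [:: arr_a i; arr_b (ordS i)])))).

Definition in_ideal (q : 'I_n -> K) (f : elt) : Prop :=
  exists s : seq (K * path * 'I_n * path),
    (forall t, t \in s -> valid t.1.1.2 && valid t.2) /\
    f = (fun r => \sum_(t <- s)
           t.1.1.1 * emul (emul (delta t.1.1.2) (brel q t.1.2)) (delta t.2) r).

(* congruence modulo I_q, i.e. equality in B_n(q) = kQ / I_q *)
Definition cong (q : 'I_n -> K) (f g : elt) : Prop := in_ideal q (eadd f (eopp g)).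

(* B_n(q) and B_n(p) are isomorphic as K-algebras: there are maps phi, psi on kQ
   inducing mutually inverse well-defined unital K-algebra homomorphisms
   kQ/I_q -> kQ/I_p and kQ/I_p -> kQ/I_q. *)
Definition B_iso (q p : 'I_n -> K) : Prop :=
  exists phi psi : elt -> elt,
    (forall f, fin_supp f -> fin_supp (phi f)) /\
    (forall f, fin_supp f -> fin_supp (psi f)) /\
    (forall f g, fin_supp f -> fin_supp g -> cong q f g -> cong p (phi f) (phi g)) /\
    (forall f g, fin_supp f -> fin_supp g -> cong p f g -> cong q (psi f) (psi g)) /\
    (forall c f g, fin_supp f -> fin_supp g ->
       cong p (phi (eadd (escale c f) g)) (eadd (escale c (phi f)) (phi g))) /\
    (forall f g, fin_supp f -> fin_supp g ->
       cong p (phi (emul f g)) (emul (phi f) (phi g))) /\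
    cong p (phi eone) eone /\
    (forall f, fin_supp f -> cong q (psi (phi f)) f) /\
    (forall g, fin_supp g -> cong p (phi (psi g)) g).

Definition shift (k : nat) (i : 'I_n) : 'I_n := iter k (@ordS n) i.

End PathAlgebra.

(* Main.v *)
From mathcomp Require Import all_boot all_algebra ring.
Require Import Defs.
From Stdlib Require Import ClassicalEpsilon FunctionalExtensionality.
Set Implicit Arguments.
Unset Strict Implicit.
Unset Printing Implicit Defensive.
Import GRing.Theory.
Local Open Scope ring_scope.

(** Both sides are equivalent to the equality of the products of the [p i] and
    of the [q i], and rescaling the loops [b_i] gives one implication.

    Conversely, let [phi : B_n(q) -> B_n(p)] be an isomorphism. A character of
    [B_n(p)] with values in [K[t]] selects a vertex [i] and sends [b_i] to a
    polynomial; pulling back the universal one at [i] along [phi] yields a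
    vertex [s i] and a polynomial [g i], where [s] is injective and [g i] has
    degree one because [phi] is surjective. The characters at [(i, x)] and
    [(i + 1, y)] have a nonsplit extension as soon as [x = p i * y], and one
    between distinct vertices [(j, x)], [(l, y)] of [B_n(q)] requires
    [l = j + 1] and [x = q j * y]. Hence
    [(g i).[p i * t] = q (s i) * (g (i + 1)).[t]]; comparing the coefficients
    of [t] and multiplying over all [i] gives the equality of the products. *)

(** * Finitely supported functions on paths and their product *)

Section PathAlgebraTheory.
Variables (K : fieldType) (n : nat).
Implicit Types (f g h : elt K n) (u v r : path n) (s : seq (arrow n)).

Notation delta := (@delta K n).
Notation ezero := (fun _ : path n => 0 : K).

Lemma delta_refl r : delta r r = 1.
Proof. by rewrite /Defs.delta eqxx. Qed.

Lemma valid_from_cat (i : 'I_n) s1 s2 :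
  valid_from i (s1 ++ s2) = valid_from i s1 && valid_from (endv i s1) s2.
Proof.
elim: s1 i => [|x s1 IH] i //=.
by rewrite IH andbA /endv.
Qed.

(** The only cut of [r] that can yield the pair [(u, v)] is the one at position [size u.2], so at
    most one summand survives. *)
Lemma sum_split_eq r u v :
  \sum_(i < (size r.2).+1)
     delta u (r.1, take i r.2) * delta v (endv r.1 (take i r.2), drop i r.2)
  = (if endv u.1 u.2 == v.1 then delta (u.1, u.2 ++ v.2) r else 0).
Proof.
rewrite /Defs.delta.
have nz (i : nat) : (r.1, take i r.2) = u ->
    (endv r.1 (take i r.2), drop i r.2) = v ->
    (endv u.1 u.2 == v.1) && (r == (u.1, u.2 ++ v.2)).
  by move=> <- <- /=; rewrite eqxx cat_take_drop -surjective_pairing eqxx.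
case: ifP => [/eqP e|ne]; last first.
  rewrite big1 // => i _.
  case: eqP => [eu|]; last by rewrite mul0r.
  case: eqP => [ev|]; last by rewrite mulr0.
  by move: (nz _ eu ev); rewrite ne.
case: eqP => [er|ne].
  have lt : (size u.2 < (size r.2).+1)%N by rewrite er /= size_cat ltnS leq_addr.
  rewrite (bigD1 (Ordinal lt)) //= [X in _ + X]big1 ?addr0 => [|i /eqP ne].
    rewrite er /= take_size_cat // drop_size_cat //.
    by rewrite -surjective_pairing eqxx e -surjective_pairing eqxx mulr1.
  case: eqP => [eu|]; last by rewrite mul0r.
  case: ne; apply/val_inj => /=; move: (congr1 (fun x => size x.2) eu) => /= <-.
  by rewrite size_takel // -ltnS ltn_ord.
rewrite big1 // => i _.
case: eqP => [eu|]; last by rewrite mul0r.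
case: eqP => [ev|]; last by rewrite mulr0.
by move: (nz _ eu ev) => /andP[_ /eqP].
Qed.

(** The list may exceed the support, so that several functions can be expanded over one common
    list. *)
Definition covers (l : seq (path n)) f := forall r, f r != 0 -> r \in l.

Lemma sum_delta f (l : seq (path n)) r :
  uniq l -> covers l f -> f r = \sum_(x <- l) f x * delta x r.
Proof.
move=> ul cl; rewrite /Defs.delta.
have [rl|rl] := boolP (r \in l).
  rewrite (bigD1_seq r) //= eqxx mulr1 big1 ?addr0 // => x.
  by rewrite eq_sym => /negbTE ->; rewrite mulr0.
rewrite big1_seq => [|x /andP[_ xl]].
  by apply/eqP; apply: contraNT rl; apply: cl.
by case: eqP xl rl => [->|_] ; [move=> -> | rewrite mulr0].
Qed.

Lemma fin_suppP f : fin_supp f ->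
  exists l, [/\ uniq l, covers l f & {in l, forall r, valid r}].
Proof.
case=> l H; exists (undup [seq r <- l | valid r]); split.
- exact: undup_uniq.
- by move=> r /H; rewrite mem_undup mem_filter andbC.
- by move=> r; rewrite mem_undup mem_filter => /andP[].
Qed.

Lemma covers_fin_supp l f : covers l f -> (forall r, f r != 0 -> valid r) ->
  fin_supp f.
Proof. by move=> cl vl; exists l => r fr; rewrite cl // vl. Qed.

Lemma fin_supp0 : fin_supp ezero.
Proof. by exists [::] => r; rewrite eqxx. Qed.

Lemma fin_supp_delta r : valid r -> fin_supp (delta r).
Proof.
move=> vr; exists [:: r] => x; rewrite /Defs.delta inE.
by case: (x =P r) => [->|_]; rewrite ?eqxx.
Qed.

Lemma fin_supp_lin c f g :
  fin_supp f -> fin_supp g -> fin_supp (eadd (escale c f) g).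
Proof.
move=> [l1 H1] [l2 H2]; exists (l1 ++ l2) => r; rewrite /eadd /escale mem_cat.
have [f0|/H1/andP[-> ->] //] := eqVneq (f r) 0.
by rewrite f0 mulr0 add0r => /H2/andP[-> ->]; rewrite orbT.
Qed.

Lemma emulE f g l1 l2 r : uniq l1 -> uniq l2 -> covers l1 f -> covers l2 g ->
  valid r ->
  emul f g r = \sum_(x <- l1) \sum_(y <- l2) (f x * g y) *
    (if endv x.1 x.2 == y.1 then delta (x.1, x.2 ++ y.2) r else 0).
Proof.
move=> u1 u2 c1 c2 vr; rewrite /emul vr.
under eq_bigr => i _.
  rewrite (sum_delta (r.1, take i r.2) u1 c1).
  rewrite (sum_delta (endv r.1 (take i r.2), drop i r.2) u2 c2).
  rewrite mulr_suml.
  under eq_bigr => x _ do rewrite mulr_sumr.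
  over.
rewrite exchange_big /=; apply: eq_bigr => x _.
rewrite exchange_big /=; apply: eq_bigr => y _.
by rewrite -sum_split_eq mulr_sumr; apply: eq_bigr => i _; rewrite mulrACA.
Qed.

Lemma covers_emul f g l1 l2 : covers l1 f -> covers l2 g ->
  covers [seq (x.1, x.2 ++ y.2) | x <- l1, y <- l2] (emul f g).
Proof.
move=> c1 c2 r; rewrite /emul; case: ifP => [_|]; last by rewrite eqxx.
apply: contraNT => nr; rewrite big1 // => i _; apply/eqP.
apply: contraNT nr; rewrite mulf_eq0 negb_or => /andP[/c1 m1 /c2 m2].
apply/allpairsP; eexists (_, _); split; [exact: m1|exact: m2|].
by rewrite /= cat_take_drop -surjective_pairing.
Qed.

Lemma fin_supp_emul f g : fin_supp f -> fin_supp g -> fin_supp (emul f g).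
Proof.
move=> /fin_suppP[l1 [_ c1 _]] /fin_suppP[l2 [_ c2 _]].
apply: covers_fin_supp (covers_emul c1 c2) _ => r.
by rewrite /emul; case: ifP => //; rewrite eqxx.
Qed.

Lemma fin_supp_eone : fin_supp (@eone K n).
Proof.
exists [seq (i, [::]) | i <- enum 'I_n] => -[i s]; rewrite /eone /=.
case: (s =P [::]) => [->|_]; last by rewrite eqxx.
by rewrite /valid /= andbT => _; apply: map_f; rewrite mem_enum.
Qed.

Lemma emul_delta u v : valid u -> valid v ->
  emul (delta u) (delta v) =
  if endv u.1 u.2 == v.1 then delta (u.1, u.2 ++ v.2) else ezero.
Proof.
move=> vu vv; apply: functional_extensionality => r.
rewrite /emul sum_split_eq; case: eqP => [e|_]; last by case: ifP.
case: ifP => // nr; rewrite /Defs.delta; case: eqP => // er; move: nr.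
by rewrite er /valid /= valid_from_cat e; move: vu vv; rewrite /valid => -> ->.
Qed.

Lemma fin_supp_brel (q : 'I_n -> K) i : fin_supp (brel q i).
Proof.
exists [:: (i, [:: arr_b i; arr_a i]); (i, [:: arr_a i; arr_b (ordS i)])] => r.
rewrite /brel /eadd /eopp /escale /Defs.delta !inE.
case: (r =P _) => [->|_]; first by rewrite /valid /= !eqxx.
case: (r =P _) => [->|_]; first by rewrite /valid /= !eqxx.
by rewrite mulr0 subr0 eqxx.
Qed.

End PathAlgebraTheory.

(** * Homomorphisms out of the path algebra and its quotients *)

Section Homomorphisms.
Variables (K : fieldType) (n : nat) (A : algType K).
Implicit Types (f g h : elt K n) (F : elt K n -> A).
Notation delta := (@delta K n).
Notation ezero := (fun _ : path n => 0 : K).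

(** [elt] contains all functions on paths; only the finitely supported ones form the path algebra,
    so the law is imposed there alone. *)
Definition linear_map F := forall c f g, fin_supp f -> fin_supp g ->
  F (eadd (escale c f) g) = c *: F f + F g.

Lemma linear_map0 F : linear_map F -> F ezero = 0.
Proof.
move=> lF; have := lF (-1) _ _ (fin_supp0 K n) (fin_supp0 K n).
rewrite scaleN1r addNr => <-; congr F; apply: functional_extensionality => r.
by rewrite /eadd /escale mulr0 addr0.
Qed.

Lemma linear_map_sum (I : Type) F (l : seq I) (P : pred I) (c : I -> K) (d : I -> elt K n) :
  linear_map F -> (forall t, P t -> fin_supp (d t)) -> all P l ->
  fin_supp (fun r => \sum_(t <- l) c t * d t r) /\
  F (fun r => \sum_(t <- l) c t * d t r) = \sum_(t <- l) c t *: F (d t).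
Proof.
move=> lF sd; elim: l => [_|t l IH] /=.
  rewrite big_nil -(linear_map0 lF).
  suff -> : (fun r => \sum_(t <- [::]) c t * d t r) = ezero by split => //; exact: fin_supp0.
  by apply: functional_extensionality => r; rewrite big_nil.
move=> /andP[Pt Pl]; have [sl Fl] := IH Pl.
have -> : (fun r => \sum_(t <- t :: l) c t * d t r) =
          eadd (escale (c t) (d t)) (fun r => \sum_(t <- l) c t * d t r).
  by apply: functional_extensionality => r; rewrite big_cons.
split; first by apply: fin_supp_lin => //; apply: sd.
by rewrite lF // ?Fl ?big_cons //; apply: sd.
Qed.

Lemma linear_mapE F f l : linear_map F -> uniq l -> covers l f ->
  {in l, forall r, valid r} -> F f = \sum_(r <- l) f r *: F (delta r).
Proof.
move=> lF ul cl vl.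
have /allP al := vl.
have [_ <-] := linear_map_sum f lF (@fin_supp_delta K n) al.
by congr F; apply: functional_extensionality => r; apply: sum_delta.
Qed.

Lemma linear_map_ext F G f : linear_map F -> linear_map G ->
  (forall r, valid r -> F (delta r) = G (delta r)) -> fin_supp f -> F f = G f.
Proof.
move=> lF lG FG /fin_suppP[l [ul cl vl]].
rewrite (linear_mapE lF ul cl vl) (linear_mapE lG ul cl vl).
by apply: eq_big_seq => r rl; rewrite FG // vl.
Qed.

Definition alg_hom F := [/\ linear_map F,
  forall f g, fin_supp f -> fin_supp g -> F (emul f g) = F f * F g
  & F (@eone K n) = 1].

Lemma emul_vertex_path (i : 'I_n) s : valid_from i s ->
  emul (delta (i, [::])) (delta (i, s)) = delta (i, s).
Proof. by move=> v; rewrite emul_delta //= eqxx. Qed.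

Lemma emul_path_vertex (i j : 'I_n) s : valid_from i s ->
  emul (delta (i, s)) (delta (j, [::])) =
  if endv i s == j then delta (i, s) else ezero.
Proof. by move=> v; rewrite emul_delta //= cats0. Qed.

Lemma emul_arrow_path (x : arrow n) s : valid_from (tgt x) s ->
  emul (delta (src x, [:: x])) (delta (tgt x, s)) = delta (src x, x :: s).
Proof. by move=> v; rewrite emul_delta /valid /= ?eqxx. Qed.

(** Induction on the path, peeling off its first arrow; the target vertex that this introduces is
    absorbed again by that arrow. *)
Lemma alg_hom_path F (i : 'I_n) s : alg_hom F -> valid_from i s ->
  F (delta (i, s)) =
  F (delta (i, [::])) * \prod_(x <- s) F (delta (src x, [:: x])).
Proof.
move=> [_ mF _]; elim: s i => [|x s IH] i; first by rewrite big_nil mulr1.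
rewrite /= => /andP[/eqP <- v]; have vx : valid (src x, [:: x]).
  by rewrite /valid /= eqxx.
rewrite -emul_arrow_path // mF; try exact: fin_supp_delta.
rewrite IH // big_cons !mulrA; congr (_ * _).
rewrite -!mF; try exact: fin_supp_delta.
by rewrite emul_vertex_path // emul_path_vertex // eqxx.
Qed.

Lemma alg_hom_ext F G f : alg_hom F -> alg_hom G ->
  (forall i, F (delta (i, [::])) = G (delta (i, [::]))) ->
  (forall x, F (delta (src x, [:: x])) = G (delta (src x, [:: x]))) ->
  fin_supp f -> F f = G f.
Proof.
move=> hF hG FGv FGa; apply: linear_map_ext; [by case: hF|by case: hG|].
move=> [i s] v; rewrite (alg_hom_path hF v) (alg_hom_path hG v) FGv.
by congr (_ * _); apply: eq_bigr => x _.
Qed.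

Definition quot_hom (q : 'I_n -> K) F :=
  alg_hom F /\ forall i, F (brel q i) = 0.

(** Each term of an element of the ideal has a factor [brel q i], which [F] kills, so [F] vanishes
    on the difference of [f] and [g]. *)
Lemma quot_hom_cong q F f g : quot_hom q F -> fin_supp f -> fin_supp g ->
  cong q f g -> F f = F g.
Proof.
move=> [[lF mF oF] bF] sf sg [l [vl e]].
have -> : f = eadd (escale 1 (eadd f (eopp g))) g.
  by apply: functional_extensionality => r; rewrite /eadd /escale /eopp mul1r subrK.
have H (t : K * path n * 'I_n * path n) : valid t.1.1.2 && valid t.2 ->
    fin_supp (emul (emul (delta t.1.1.2) (brel q t.1.2)) (delta t.2)).
  move=> /andP[v1 v2]; apply: fin_supp_emul; last exact: fin_supp_delta.
  by apply: fin_supp_emul; [exact: fin_supp_delta|exact: fin_supp_brel].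
have /allP al := vl.
have [sl Fl] := linear_map_sum (fun t => t.1.1.1) lF H al.
rewrite lF //; last by rewrite e.
rewrite e Fl big1_seq ?scaler0 ?add0r // => t /andP[_ /vl/andP[v1 v2]].
rewrite !mF ?bF ?mulr0 ?mul0r ?scaler0 //; try exact: fin_supp_delta.
- exact: fin_supp_brel.
- by apply: fin_supp_emul; [exact: fin_supp_delta|exact: fin_supp_brel].
Qed.

(** The relation runs from [e_i] to [e_{i+1}], so multiplying it by these two vertices exhibits it
    as a single term of the ideal. *)
Lemma brel_cong0 q i : cong q (brel q i) ezero.
Proof.
exists [:: (1, (i, [::]), i, (ordS i, [::]))]; split.
  by move=> t; rewrite inE => /eqP ->.
apply: functional_extensionality => r; rewrite big_seq1 mul1r /= /eadd /eopp oppr0 addr0.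
have L (f : elt K n) : (forall r, f r != 0 -> valid r && (r.1 == i) && (endv r.1 r.2 == ordS i)) ->
    emul (emul (delta (i, [::])) f) (delta (ordS i, [::])) = f.
  move=> Hf; apply: functional_extensionality => {}r; rewrite /emul.
  case: ifP => vr; last first.
    by apply/esym/eqP; apply: contraFT vr => /Hf/andP[/andP[]].
  (* Only the last cut matches the right-hand vertex, and afterwards only the first cut matches the
     left-hand one. *)
  rewrite big_ord_recr /= big1 ?add0r => [|k _]; last first.
    rewrite /Defs.delta; case: eqP; last by rewrite mulr0.
    by move=> [_ /(congr1 size)/eqP]; rewrite size_drop subn_eq0 leqNgt ltn_ord.
  rewrite take_size drop_size -surjective_pairing vr.
  rewrite big_ord_recl /= take0 drop0 /= [X in _ + X]big1 ?addr0 => [|k _]; last first.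
    rewrite /Defs.delta /bump /=; case: eqP; last by rewrite mul0r.
    by move=> [_ /(congr1 size)/=/eqP]; rewrite size_takel // ltn_ord.
  rewrite /endv /= -surjective_pairing /Defs.delta.
  have [->|/Hf/andP[/andP[_ /eqP ->]]] := eqVneq (f r) 0; first by rewrite mulr0 mul0r.
  by rewrite /endv => /eqP ->; rewrite !eqxx mul1r mulr1.
rewrite L // => {}r; rewrite /brel /eadd /eopp /escale /Defs.delta.
case: (r =P _) => [->|_]; first by rewrite /valid /endv /= !eqxx.
case: (r =P _) => [->|_]; first by rewrite /valid /endv /= !eqxx.
by rewrite mulr0 subr0 eqxx.
Qed.

Lemma quot_hom_rel q F i : quot_hom q F ->
  F (delta (i, [:: arr_b i; arr_a i])) =
  q i *: F (delta (i, [:: arr_a i; arr_b (ordS i)])).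
Proof.
move=> [[lF _ _] bF]; set x := delta _; set y := delta _.
have sx : fin_supp x by apply: fin_supp_delta; rewrite /valid /= !eqxx.
have sy : fin_supp y by apply: fin_supp_delta; rewrite /valid /= !eqxx.
have -> : x = eadd (escale (q i) y) (brel q i).
  apply: functional_extensionality => r.
  by rewrite /brel /eadd /escale /eopp addrC subrK.
by rewrite lF ?bF ?addr0 //; apply: fin_supp_brel.
Qed.

(** * The homomorphism determined by images of vertices and arrows *)

Section Lift.
Variables (e : 'I_n -> A) (x : arrow n -> A).

(* [fin_supp] gives a support only existentially; the choice is immaterial by [liftE]. *)
Definition supp f := undup (epsilon (inhabits [::]) (fun l => covers l f)).
Definition path_val (r : path n) : A := e r.1 * \prod_(y <- r.2) x y.
Definition lift f : A := \sum_(r <- supp f) f r *: path_val r.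

Lemma supp_covers f : fin_supp f -> covers (supp f) f.
Proof.
move=> [l H]; have /epsilon_spec E : exists l, covers l f.
  by exists l => r /H/andP[].
by move=> r /E; rewrite mem_undup.
Qed.

(** Once the zeros of [f] are removed, any two duplicate-free covering lists are permutations of
    each other. *)
Lemma liftE f l : fin_supp f -> uniq l -> covers l f ->
  lift f = \sum_(r <- l) f r *: path_val r.
Proof.
move=> /supp_covers cs ul cl.
have H (l1 : seq (path n)) : \sum_(r <- l1) f r *: path_val r =
    \sum_(r <- [seq r <- l1 | f r != 0]) f r *: path_val r.
  rewrite big_filter [LHS](bigID (fun r => f r != 0)) /= [X in _ + X]big1 ?addr0 //.
  by move=> r; rewrite negbK => /eqP ->; rewrite scale0r.
rewrite /lift H [RHS]H; apply: perm_big; apply: uniq_perm.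
- exact: filter_uniq (undup_uniq _).
- exact: filter_uniq.
move=> r; rewrite !mem_filter; case: eqP => //= /eqP fr.
by rewrite cs // cl.
Qed.

Lemma lift_linear : linear_map lift.
Proof.
move=> c f g sf sg.
pose l := undup (supp f ++ supp g).
have cf : covers l f by move=> r /(supp_covers sf) H; rewrite mem_undup mem_cat H.
have cg : covers l g by move=> r /(supp_covers sg) H; rewrite mem_undup mem_cat H orbT.
have ul : uniq l by exact: undup_uniq.
rewrite (liftE sf ul cf) (liftE sg ul cg) (liftE (fin_supp_lin c sf sg) ul).
  rewrite scaler_sumr -big_split /=; apply: eq_bigr => r _.
  by rewrite scalerA -scalerDl.
move=> r; rewrite /eadd /escale.
have [f0|/cf //] := eqVneq (f r) 0.
by rewrite f0 mulr0 add0r => /cg.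
Qed.

Lemma lift_delta r : valid r -> lift (delta r) = path_val r.
Proof.
move=> v; rewrite (liftE (l := [:: r])) ?big_seq1 ?delta_refl ?scale1r //.
  exact: fin_supp_delta.
by move=> u; rewrite inE /Defs.delta; case: ifP; rewrite // eqxx.
Qed.

Hypothesis e_orth : forall i j, e i * e j = if i == j then e i else 0.
Hypothesis e_sum : \sum_i e i = 1.
Hypothesis x_src : forall y, e (src y) * x y = x y.
Hypothesis x_tgt : forall y, x y * e (tgt y) = x y.

(** By [x_tgt] each arrow carries the idempotent of its target, so orthogonality tests [j] against
    the end of the path. *)
Lemma path_val_vertex i s j : valid_from i s ->
  e i * \prod_(y <- s) x y * e j =
  if endv i s == j then e i * \prod_(y <- s) x y else 0.
Proof.
elim: s i => [|y s IH] i /=; first by rewrite big_nil mulr1 e_orth.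
move=> /andP[_ /IH]; rewrite big_cons -[x y]x_tgt.
rewrite -!mulrA => ->; rewrite /endv /=.
by case: ifP => _; rewrite ?mulr0.
Qed.

Lemma path_val_mul (u v : path n) : valid u -> path_val u * path_val v =
  if endv u.1 u.2 == v.1 then path_val (u.1, u.2 ++ v.2) else 0.
Proof.
move=> vu; rewrite /path_val mulrA path_val_vertex //.
by case: ifP => _; rewrite ?mul0r // big_cat mulrA.
Qed.

Lemma lift_mul f g : fin_supp f -> fin_supp g -> lift (emul f g) = lift f * lift g.
Proof.
move=> sf sg; have [l1 [u1 c1 v1]] := fin_suppP sf.
have [l2 [u2 c2 v2]] := fin_suppP sg.
pose l := undup [seq (x.1, x.2 ++ y.2) | x <- l1, y <- l2].
have cl : covers l (emul f g) by move=> r /(covers_emul c1 c2); rewrite mem_undup.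
rewrite (liftE (fin_supp_emul sf sg) (undup_uniq _) cl) -/l.
rewrite (liftE sf u1 c1) (liftE sg u2 c2).
pose m (a b : path n) := (a.1, a.2 ++ b.2).
pose ok (a b : path n) := endv a.1 a.2 == b.1.
(* The sum is regrouped over pairs [(a, b)]: a composable pair contributes only at the path
   [m a b]. *)
transitivity (\sum_(r <- l) \sum_(a <- l1) \sum_(b <- l2)
   (f a * g b * (if ok a b then delta (m a b) r else 0)) *: path_val r).
  apply: eq_big_seq => r rl; have [vr|nv] := boolP (valid r).
    rewrite (emulE u1 u2 c1 c2 vr) scaler_suml; apply: eq_bigr => a _.
    by rewrite scaler_suml.
  (* At an invalid [r] the product is 0 by definition; the right-hand side agrees, since composable
     valid paths concatenate to a valid one. *)
  rewrite {1}/emul (negbTE nv) scale0r big1_seq // => a /andP[_ al].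
  rewrite big1_seq // => b /andP[_ bl].
  rewrite /ok /Defs.delta; case: eqP => ok_ab; last by rewrite mulr0 scale0r.
  case: eqP => e_r; last by rewrite mulr0 scale0r.
  case/negP: nv; rewrite e_r /valid /= valid_from_cat ok_ab.
  by apply/andP; split; [exact: v1|exact: v2].
rewrite exchange_big /= mulr_suml; apply: eq_big_seq => a al.
rewrite exchange_big /= mulr_sumr; apply: eq_big_seq => b bl.
rewrite -scalerAl -scalerAr scalerA path_val_mul ?v1 // -/(ok a b).
case: ifP => _; last by rewrite scaler0 big1 // => r _; rewrite mulr0 scale0r.
rewrite (bigD1_seq (m a b)) ?undup_uniq //=; last first.
  by rewrite mem_undup; apply/allpairsP; exists (a, b).
rewrite delta_refl mulr1 big1 ?addr0 // => r.
by rewrite /Defs.delta => /negbTE ->; rewrite mulr0 scale0r.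
Qed.

Lemma lift_one : lift (@eone K n) = 1.
Proof.
rewrite (@liftE _ [seq (i, [::]) | i <- enum 'I_n]); first last.
- move=> [i s]; rewrite /eone /=; case: (s =P [::]) => [->|_]; last by rewrite eqxx.
  by move=> _; apply: map_f; rewrite mem_enum.
- by rewrite map_inj_uniq ?enum_uniq // => i j [].
- exact: fin_supp_eone.
rewrite big_map big_enum -e_sum; apply: eq_bigr => i _.
by rewrite /eone /path_val /= big_nil scale1r mulr1.
Qed.

Lemma lift_alg_hom : alg_hom lift.
Proof. by split; [exact: lift_linear|exact: lift_mul|exact: lift_one]. Qed.

Lemma lift_vertex i : lift (delta (i, [::])) = e i.
Proof. by rewrite lift_delta // /path_val big_nil mulr1. Qed.

Lemma lift_arrow y : lift (delta (src y, [:: y])) = x y.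
Proof. by rewrite lift_delta /path_val ?big_seq1 ?x_src // /valid /= eqxx. Qed.

Lemma lift_quot_hom (q : 'I_n -> K) :
  (forall i, x (arr_b i) * x (arr_a i) = q i *: (x (arr_a i) * x (arr_b (ordS i)))) ->
  quot_hom q lift.
Proof.
move=> H; split=> [|i]; first exact: lift_alg_hom.
have v1 : valid (i, [:: arr_b i; arr_a i]) by rewrite /valid /= !eqxx.
have v2 : valid (i, [:: arr_a i; arr_b (ordS i)]) by rewrite /valid /= !eqxx.
have -> : brel q i = eadd (escale (- q i) (delta (i, [:: arr_a i; arr_b (ordS i)])))
                          (delta (i, [:: arr_b i; arr_a i])).
  by apply: functional_extensionality => r; rewrite /brel /eadd /eopp /escale addrC mulNr.
rewrite lift_linear ?lift_delta //; try exact: fin_supp_delta.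
by rewrite /path_val !big_cons !big_nil !mulr1 H /= scaleNr scalerAr addNr.
Qed.

End Lift.
End Homomorphisms.

(** * Rescaling the loops, and equality of products *)

Section DiagonalIsomorphism.
Variables (K : fieldType) (n : nat).
Implicit Types (f g : elt K n) (a q p : 'I_n -> K).
Notation delta := (@delta K n).

Definition weight a (s : seq (arrow n)) : K := \prod_(x <- s) (if x.1 then a x.2 else 1).
(** The diagonal endomorphism of the path algebra that multiplies each loop [b_i] by [a i] and fixes
    the vertices and the arrows [a_i]. *)
Definition twist a f : elt K n := fun r => weight a r.2 * f r.

Lemma twist_emul a f g : twist a (emul f g) = emul (twist a f) (twist a g).
Proof.
apply: functional_extensionality => r; rewrite /twist /emul.
case: ifP => _; last by rewrite mulr0.
rewrite mulr_sumr; apply: eq_bigr => i _ /=.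
by rewrite mulrACA /weight -big_cat cat_take_drop.
Qed.

Lemma twist_delta a u : twist a (delta u) = escale (weight a u.2) (delta u).
Proof.
apply: functional_extensionality => r; rewrite /twist /escale /Defs.delta.
by case: eqP => [->|]; rewrite ?mulr0.
Qed.

Lemma emul_scalel c f g : emul (escale c f) g = escale c (emul f g).
Proof.
apply: functional_extensionality => r; rewrite /escale /emul.
case: ifP; rewrite ?mulr0 // mulr_sumr => _.
by apply: eq_bigr => i _; rewrite mulrA.
Qed.

Lemma emul_scaler c f g : emul f (escale c g) = escale c (emul f g).
Proof.
apply: functional_extensionality => r; rewrite /escale /emul.
case: ifP; rewrite ?mulr0 // mulr_sumr => _.
by apply: eq_bigr => i _; rewrite mulrCA.
Qed.

Section Twist.
Variables (a q p : 'I_n -> K).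
Hypothesis a_neq0 : forall i, a i != 0.
Hypothesis pE : forall i, p i = a (ordS i) / a i * q i.

(** The path [b_i a_i] acquires the factor [a i] and [a_i b_{i+1}] the factor [a (ordS i)]; the
    condition [pE] says [a (ordS i) * q i = a i * p i]. *)
Lemma twist_brel i : twist a (brel q i) = escale (a i) (brel p i).
Proof.
apply: functional_extensionality => r.
rewrite /twist /brel /escale /eadd /eopp pE /Defs.delta.
case: (r =P _) => [->|_] /=.
  case: eqP => [//|_]; rewrite /weight !big_cons big_nil /= !mulr1 mulr0 subr0.
  by rewrite mulr0 subr0.
case: (r =P _) => [->|_] /=; last by rewrite !mulr0 subr0 !mulr0.
rewrite /weight !big_cons big_nil /=; field; exact: a_neq0.
Qed.

Lemma twist_cong f g : cong q f g -> cong p (twist a f) (twist a g).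
Proof.
move=> [l [vl e]].
(* The paths of each term stay; its coefficient absorbs the weights of the two outer paths and the
   factor [a i] from [twist_brel]. *)
exists [seq (t.1.1.1 * weight a t.1.1.2.2 * weight a t.2.2 * a t.1.2,
             t.1.1.2, t.1.2, t.2) | t <- l].
split; first by move=> _ /mapP[t /vl ? ->].
apply: functional_extensionality => r; rewrite big_map /=.
transitivity (twist a (eadd f (eopp g)) r).
  by rewrite /twist /eadd /eopp mulrDr mulrN.
rewrite e /twist mulr_sumr; apply: eq_bigr => t _.
transitivity (t.1.1.1 *
   twist a (emul (emul (delta t.1.1.2) (brel q t.1.2)) (delta t.2)) r).
  by rewrite /twist mulrCA.
rewrite !twist_emul !twist_delta twist_brel.
rewrite !(emul_scalel, emul_scaler) /escale !mulrA.
by ring.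
Qed.

Lemma fin_supp_twist f : fin_supp f -> fin_supp (twist a f).
Proof.
move=> [l H]; exists l => r fr; apply: H; apply: contraNneq fr => fr.
by rewrite /twist fr mulr0.
Qed.

Lemma twist_one : twist a (@eone K n) = @eone K n.
Proof.
apply: functional_extensionality => -[i s]; rewrite /twist /eone /=.
by case: eqP => [->|_]; rewrite ?mulr0 // /weight big_nil mul1r.
Qed.

Lemma twist_lin c f g :
  twist a (eadd (escale c f) g) = eadd (escale c (twist a f)) (twist a g).
Proof.
apply: functional_extensionality => r.
by rewrite /twist /eadd /escale mulrDr mulrCA.
Qed.

Lemma twistK f : twist (fun i => (a i)^-1) (twist a f) = f.
Proof.
apply: functional_extensionality => r; rewrite /twist mulrA /weight -big_split /=.
rewrite big1 ?mul1r // => x _; case: x.1; last by rewrite mulr1.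
by rewrite mulVf.
Qed.

End Twist.

Lemma cong_refl q f : cong q f f.
Proof.
exists [::]; split => //; apply: functional_extensionality => r.
by rewrite big_nil /eadd /eopp subrr.
Qed.

Lemma B_iso_twist a q p : (forall i, a i != 0) ->
  (forall i, p i = a (ordS i) / a i * q i) -> B_iso q p.
Proof.
move=> a0 pE; pose b i := (a i)^-1.
have b0 i : b i != 0 by rewrite invr_eq0.
have qE i : q i = b (ordS i) / b i * p i.
  by rewrite pE /b invrK; field; rewrite !a0.
have bK : (fun i => (b i)^-1) = a.
  by apply: functional_extensionality => i; rewrite invrK.
exists (twist a), (twist b); do ![split] => *.
- exact: fin_supp_twist.
- exact: fin_supp_twist.
- exact: twist_cong.
- exact: twist_cong.
- by rewrite twist_lin; apply: cong_refl.
- by rewrite twist_emul; apply: cong_refl.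
- by rewrite twist_one; apply: cong_refl.
- by rewrite twistK //; apply: cong_refl.
- by rewrite -{1}bK twistK //; apply: cong_refl.
Qed.

(** The recursion [a (i + 1) = (p i / q i) * a i] starting at 1 is solved by partial products; it
    closes up around the cycle because the full product of the ratios is 1. *)
Lemma prod_eq_telescope q p : (forall i, q i != 0) -> (forall i, p i != 0) ->
  \prod_i p i = \prod_i q i ->
  exists2 a : 'I_n -> K, forall i, a i != 0 &
    forall i, p i = a (ordS i) / a i * q i.
Proof.
move=> q0 p0 pq; pose c i := p i / q i.
have c0 i : c i != 0 by rewrite mulf_neq0 // invr_eq0.
pose a (i : 'I_n) : K := \prod_(j : 'I_n | (j < i)%N) c j.
have a0 i : a i != 0 by apply/prodf_neq0 => j _.
exists a => // i.
suff -> : a (ordS i) = c i * a i by rewrite mulfK // mulfVK.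
have -> : c i * a i = \prod_(j : 'I_n | (j <= i)%N) c j.
  rewrite (bigD1 i) //=; congr (_ * _); apply: eq_bigl => j.
  by rewrite ltn_neqAle andbC.
rewrite /a /=; have [lt|ge] := ltnP i.+1 n; first by rewrite modn_small.
(* At the last index [ordS i] wraps to 0, where [a] is an empty product. *)
have -> : i.+1 = n by apply/eqP; rewrite eqn_leq ge ltn_ord.
rewrite modnn big_pred0 // [RHS](eq_bigl xpredT) => [|j]; last first.
  by rewrite -ltnS (leq_trans (ltn_ord j)).
by rewrite prodf_div pq divff //; apply/prodf_neq0 => j _.
Qed.

Lemma shift_inj k : injective (@shift n k).
Proof. by elim: k => [|k IH] i j //= /(can_inj (@ordSK n))/IH. Qed.

(** The shift permutes the indices, and the ratios of [a] cancel around the cycle. *)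
Lemma prod_shift_twist a q p k : (forall i, a i != 0) ->
  (forall i, p i = a (ordS (shift k i)) / a (shift k i) * q (shift k i)) ->
  \prod_i p i = \prod_i q i.
Proof.
have prodS k' (F : 'I_n -> K) : \prod_i F (shift k' i) = \prod_i F i.
  by rewrite [RHS](reindex_inj (@shift_inj k')).
move=> a0 pE; under eq_bigr => i _ do rewrite pE.
rewrite big_split /= prodf_div prodS [\prod_i q (shift k i)]prodS.
rewrite (prodS k (fun i => a (ordS i))) (prodS 1%N) divff ?mul1r //.
exact/prodf_neq0.
Qed.

End DiagonalIsomorphism.

(** * Characters with polynomial values *)

Section Representations.
Variables (K : fieldType) (n : nat).
Hypothesis n_ge2 : (2 <= n)%N.
Implicit Types (f g : elt K n) (q p : 'I_n -> K) (i j l m : 'I_n).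
Notation delta := (@delta K n).
Notation vtx i := (delta (i, [::])).
Notation arr x := (delta (src x, [:: x])).

Lemma ordS_neq i : (ordS i == i) = false.
Proof.
apply/negP => /eqP/(congr1 val)/=.
have [lt|ge] := ltnP i.+1 n; first by rewrite modn_small // => /eqP; rewrite eqn_leq ltnn.
have e : i.+1 = n by apply/eqP; rewrite eqn_leq ge ltn_ord.
by rewrite e modnn => i0; move: n_ge2; rewrite -e -i0.
Qed.

(** The universal character at the vertex [j]: evaluating the indeterminate at a scalar prescribes
    the value of [b_j]. *)
Definition line_char j : elt K n -> {poly K} :=
  lift (fun m => (m == j)%:R) (fun x => if x.1 && (x.2 == j) then 'X else 0).

Lemma natrbM (R : nzRingType) (b c : bool) : b%:R * c%:R = (b && c)%:R :> R.
Proof. by case: b; case: c; rewrite ?mulr1 ?mulr0. Qed.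

Fact line_char_orth j i l :
  (i == j)%:R * (l == j)%:R = if i == l then (i == j)%:R else 0 :> {poly K}.
Proof.
rewrite natrbM; case: (i =P l) => [->|ne]; first by rewrite andbb.
by case: eqP => [ij|//]; case: eqP => // lj; case: ne; rewrite ij lj.
Qed.

Fact line_char_src j (x : arrow n) :
  (src x == j)%:R * (if x.1 && (x.2 == j) then 'X else 0) =
  (if x.1 && (x.2 == j) then 'X else 0) :> {poly K}.
Proof. by case: x => [[] m] /=; case: eqP; rewrite ?mul1r ?mulr0. Qed.

Fact line_char_tgt j (x : arrow n) :
  (if x.1 && (x.2 == j) then 'X else 0) * (tgt x == j)%:R =
  (if x.1 && (x.2 == j) then 'X else 0) :> {poly K}.
Proof. by case: x => [[] m] /=; rewrite /tgt /=; [case: eqP => _|]; rewrite ?mulr1 ?mul0r. Qed.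

(** Both terms of every relation contain an arrow [a_i], which is sent to 0, so [q] is arbitrary. *)
Lemma line_char_hom q j : quot_hom q (line_char j).
Proof.
apply: lift_quot_hom.
- exact: line_char_orth.
- by rewrite (bigD1 j) //= eqxx big1 ?addr0 // => i /negbTE ->.
- exact: line_char_tgt.
- by move=> i /=; rewrite mulr0 mul0r scaler0.
Qed.

Lemma line_char_vertex j i : line_char j (vtx i) = (i == j)%:R.
Proof. exact: lift_vertex. Qed.

Lemma line_char_arrow j (x : arrow n) :
  line_char j (arr x) = if x.1 && (x.2 == j) then 'X else 0.
Proof. exact: (lift_arrow (line_char_src j)). Qed.

Lemma vertex_orth (A : algType K) (F : elt K n -> A) i j : alg_hom F ->
  F (vtx i) * F (vtx j) = if i == j then F (vtx i) else 0.
Proof.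
move=> [lF mF _]; rewrite -mF; try exact: fin_supp_delta.
rewrite emul_path_vertex // /endv /=.
by case: eqP => _; rewrite ?(linear_map0 lF).
Qed.

Lemma vertex_sum (A : algType K) (F : elt K n -> A) : alg_hom F ->
  \sum_i F (vtx i) = 1.
Proof.
move=> [lF _ <-].
rewrite (@linear_mapE _ _ _ F _ [seq (i, [::]) | i <- enum 'I_n] lF).
- rewrite big_map big_enum; apply: eq_bigr => i _.
  by rewrite /eone /= scale1r.
- by rewrite map_inj_uniq ?enum_uniq // => i j [].
- move=> [i s]; rewrite /eone /=; case: (s =P [::]) => [->|_]; last by rewrite eqxx.
  by move=> _; apply: map_f; rewrite mem_enum.
- by move=> r /mapP[i _ ->].
Qed.

Lemma valid_arr (x : arrow n) : valid (src x, [:: x]).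
Proof. by rewrite /valid /= eqxx. Qed.

Lemma fin_supp_vtx i : fin_supp (vtx i).
Proof. exact: fin_supp_delta. Qed.

Lemma fin_supp_arr (x : arrow n) : fin_supp (arr x).
Proof. exact: fin_supp_delta (valid_arr x). Qed.

Lemma emul_src_arr (x : arrow n) : emul (vtx (src x)) (arr x) = arr x.
Proof. exact: emul_vertex_path (valid_arr x). Qed.

Lemma emul_arr_tgt (x : arrow n) : emul (arr x) (vtx (tgt x)) = arr x.
Proof.
by rewrite (emul_path_vertex K _ (valid_arr x)) /endv /= eqxx.
Qed.

Lemma arrow_src (A : algType K) (F : elt K n -> A) (x : arrow n) : alg_hom F ->
  F (vtx (src x)) * F (arr x) = F (arr x).
Proof.
move=> [_ mF _]; rewrite -mF ?emul_src_arr //.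
  exact: fin_supp_vtx.
exact: fin_supp_arr.
Qed.

Lemma arrow_tgt (A : algType K) (F : elt K n -> A) (x : arrow n) : alg_hom F ->
  F (arr x) * F (vtx (tgt x)) = F (arr x).
Proof.
move=> [_ mF _]; rewrite -mF ?emul_arr_tgt //.
  exact: fin_supp_arr.
exact: fin_supp_vtx.
Qed.

(* A polynomial ring has no idempotents other than 0 and 1, so a character
   picks one vertex, and it kills every arrow joining distinct vertices. *)
Lemma line_char_classification (F : elt K n -> {poly K}) : alg_hom F ->
  exists (j : 'I_n) (g : {poly K}), forall f, fin_supp f -> F f = line_char j f \Po g.
Proof.
move=> hF.
have [j nzj] : exists j, F (vtx j) != 0.
  apply/existsP; rewrite -negb_forall; apply/negP => /forallP z.
  have := vertex_sum hF; rewrite big1 => [/esym/eqP|i _]; first by rewrite oner_eq0.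
  exact/eqP.
have Fj : F (vtx j) = 1.
  by apply: (mulfI nzj); rewrite vertex_orth // eqxx mulr1.
have Fv i : F (vtx i) = (i == j)%:R.
  have := vertex_orth j i hF; rewrite Fj mul1r eq_sym => ->.
  by case: eqP.
exists j, (F (arr (arr_b j))) => f sf.
have [[lX mX oX] _] := line_char_hom (fun=> 0) j.
apply: (alg_hom_ext (G := fun f => line_char j f \Po F (arr (arr_b j)))) => //.
- split => [c h k sh sk|h k sh sk|]; first by rewrite lX // comp_polyD comp_polyZ.
    by rewrite mX // comp_polyM.
  by rewrite oX comp_polyC.
- by move=> i; rewrite line_char_vertex Fv; case: eqP => _; rewrite comp_polyC.
(* Sandwiched between the images of its endpoints, an arrow survives only if it is the loop at [j];
   [ordS_neq], hence [n >= 2], excludes [a_j]. *)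
- move=> x; rewrite line_char_arrow -(arrow_src x hF) -[F (arr x)](arrow_tgt x hF) !Fv.
  case: x => [[] m] /=; rewrite /tgt /src /=; case: (m =P j) => [->|_] /=.
  + by rewrite comp_polyX mul1r mulr1.
  + by rewrite comp_poly0 mul0r.
  + by rewrite comp_poly0 ordS_neq mulr0 mul1r.
  + by rewrite comp_poly0 mul0r.
Qed.

(** * Triangular representations of dimension two *)

Definition tri (x y z : K) : 'M[K]_2 :=
  \matrix_(i, j) if i == 0 then (if j == 0 then x else y)
                 else (if j == 0 then 0 else z).

Lemma mul_mx2 (M N : 'M[K]_2) (i j : 'I_2) : (M * N) i j = M i 0 * N 0 j + M i 1 * N 1 j.
Proof. by rewrite mxE !big_ord_recl big_ord0 addr0; congr (_ + M i _ * N _ j); apply/val_inj. Qed.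

Lemma ord2P (P : 'I_2 -> Prop) : P 0 -> P 1 -> forall d, P d.
Proof.
move=> P0 P1 [[|[|//]] h].
- by rewrite (_ : Ordinal h = 0) //; apply/val_inj.
- by rewrite (_ : Ordinal h = 1) //; apply/val_inj.
Qed.

Lemma tri_mul x y z x' y' z' :
  tri x y z * tri x' y' z' = tri (x * x') (x * y' + y * z') (z * z').
Proof.
apply/matrixP; apply: ord2P; apply: ord2P; rewrite mul_mx2 !mxE /=;
by rewrite ?mul0r ?mulr0 ?addr0 ?add0r.
Qed.

Lemma tri_scale c x y z : c *: tri x y z = tri (c * x) (c * y) (c * z).
Proof.
by apply/matrixP; apply: ord2P; apply: ord2P; rewrite !mxE /= ?mulr0.
Qed.

Lemma tri0 : tri 0 0 0 = 0.
Proof. by apply/matrixP; apply: ord2P; apply: ord2P; rewrite !mxE. Qed.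

(** Paths are read left to right, so with [e_i] in the first diagonal position and [e_{i+1}] in the
    second, [a_i] lies in the upper corner. *)
Definition tri_vertex i m := tri (m == i)%:R 0 (m == ordS i)%:R.
Definition tri_arrow (c t : K) i (x : arrow n) :=
  if x.1 then tri ((x.2 == i)%:R * (c * t)) 0 ((x.2 == ordS i)%:R * t)
  else tri 0 (x.2 == i)%:R 0.

(* The nonsplit extension of the characters of parameter [c * t] at vertex [i]
   and of parameter [t] at vertex [i + 1]. *)
Definition tri_rep (c t : K) i : elt K n -> 'M[K]_2 :=
  lift (tri_vertex i) (tri_arrow c t i).

Fact tri_arrow_src c t i (x : arrow n) :
  tri_vertex i (src x) * tri_arrow c t i x = tri_arrow c t i x.
Proof.
case: x => [[] m]; rewrite /src /tri_arrow /tri_vertex /= tri_mul;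
by case: (m == i); case: (m == ordS i);
  rewrite !(mul1r, mulr1, mul0r, mulr0, addr0, add0r).
Qed.

Fact tri_arrow_tgt c t i (x : arrow n) :
  tri_arrow c t i x * tri_vertex i (tgt x) = tri_arrow c t i x.
Proof.
case: x => [[] m]; rewrite /tgt /tri_arrow /tri_vertex /= tri_mul.
  by case: (m == i); case: (m == ordS i);
    rewrite !(mul1r, mulr1, mul0r, mulr0, addr0, add0r).
rewrite (inj_eq (can_inj (@ordSK n))).
by rewrite natrbM andbb !(mulr0, mul0r, add0r).
Qed.

(** Only the relation at [i] has content: its corner entry forces the first diagonal parameter to be
    [q i] times the second. *)
Lemma tri_rep_hom q t i : quot_hom q (tri_rep (q i) t i).
Proof.
apply: lift_quot_hom.
- move=> j l; rewrite /tri_vertex tri_mul !(mulr0, mul0r, addr0) !natrbM.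
  case: (j =P l) => [->|ne]; first by rewrite !andbb.
  have z k : (j == k) && (l == k) = false.
    by case: eqP => [jk|//]; case: eqP => // lk; case: ne; rewrite jk lk.
  by rewrite !z tri0.
- apply/matrixP; apply: ord2P; apply: ord2P; rewrite summxE !mxE /=.
  + under eq_bigr => j _ do rewrite mxE /=.
    by rewrite (bigD1 i) //= eqxx big1 ?addr0 // => j /negbTE ->.
  + by rewrite big1 // => j _; rewrite mxE.
  + by rewrite big1 // => j _; rewrite mxE.
  + under eq_bigr => j _ do rewrite mxE /=.
    by rewrite (bigD1 (ordS i)) //= eqxx big1 ?addr0 // => j /negbTE ->.
- exact: tri_arrow_tgt.
- move=> m; rewrite /tri_arrow /= !tri_mul tri_scale !(mulr0, mul0r, addr0, add0r).
  rewrite (inj_eq (can_inj (@ordSK n))); congr (tri _ _ _).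
  case: eqP => [->|_]; last by rewrite !mul0r mulr0.
  by rewrite !mul1r mulr1.
Qed.

Lemma tri_rep_vertex c t i m : tri_rep c t i (vtx m) = tri_vertex i m.
Proof. exact: lift_vertex. Qed.

Lemma tri_rep_arrow c t i (x : arrow n) : tri_rep c t i (arr x) = tri_arrow c t i x.
Proof. exact: (lift_arrow (tri_arrow_src c t i)). Qed.

(** No finiteness of [f] enters: [lift] is always a finite combination of products of upper
    triangular matrices. *)
Lemma tri_rep_lower c t i f : tri_rep c t i f 1 0 = 0.
Proof.
rewrite /tri_rep /lift summxE big1 // => r _; rewrite mxE.
suff -> : path_val (tri_vertex i) (tri_arrow c t i) r 1 0 = 0 by rewrite mulr0.
rewrite /path_val mul_mx2 {1}/tri_vertex !mxE /= mul0r add0r.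
suff -> : (\prod_(y <- r.2) tri_arrow c t i y) 1 0 = 0 by rewrite mulr0.
apply: (big_ind (fun M : 'M[K]_2 => M 1 0 = 0)).
- by rewrite mxE.
- by move=> M N M0 N0; rewrite mul_mx2 M0 N0 mul0r mulr0 addr0.
- by move=> x _; rewrite /tri_arrow; case: x.1; rewrite mxE.
Qed.

(** Diagonal entries of upper triangular matrices multiply separately; [K^o] is the field as an
    algebra over itself. *)
Lemma diag_hom (F : elt K n -> 'M[K]_2) d : alg_hom F ->
  (forall f, F f 1 0 = 0) -> alg_hom (fun f => F f d d : K^o).
Proof.
move=> [lF mF oF] F10; split=> [c f g sf sg|f g sf sg|].
- by rewrite lF // !mxE.
- rewrite mF // mul_mx2; move: d; apply: ord2P.
  + by rewrite (F10 g) mulr0 addr0.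
  + by rewrite (F10 f) mul0r add0r.
- by rewrite oF mxE eqxx.
Qed.

Lemma horner_hom (F : elt K n -> {poly K}) c : alg_hom F ->
  alg_hom (fun f => (F f).[c] : K^o).
Proof.
move=> [lF mF oF]; split=> [k f g sf sg|f g sf sg|].
- by rewrite lF // hornerD hornerZ.
- by rewrite mF // hornerM.
- by rewrite oF hornerC.
Qed.

Lemma tri_rep_diag0 q t i f : fin_supp f ->
  tri_rep (q i) t i f 0 0 = (line_char i f).[q i * t].
Proof.
have [hT _] := tri_rep_hom q t i; have [hX _] := line_char_hom q i.
apply: (alg_hom_ext (diag_hom 0 hT (tri_rep_lower _ _ _)) (horner_hom _ hX)).
- by move=> j; rewrite tri_rep_vertex line_char_vertex mxE /=; case: eqP; rewrite hornerC.
- move=> [[] m]; rewrite tri_rep_arrow line_char_arrow /tri_arrow /= !mxE /=.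
    by case: eqP => _; rewrite ?hornerX ?hornerC ?mul1r ?mul0r.
  by rewrite hornerC.
Qed.

Lemma tri_rep_diag1 q t i f : fin_supp f ->
  tri_rep (q i) t i f 1 1 = (line_char (ordS i) f).[t].
Proof.
have [hT _] := tri_rep_hom q t i; have [hX _] := line_char_hom q (ordS i).
apply: (alg_hom_ext (diag_hom 1 hT (tri_rep_lower _ _ _)) (horner_hom _ hX)).
- by move=> j; rewrite tri_rep_vertex line_char_vertex mxE /=; case: eqP; rewrite hornerC.
- move=> [[] m]; rewrite tri_rep_arrow line_char_arrow /tri_arrow /= !mxE /=.
    by case: eqP => _; rewrite ?hornerX ?hornerC ?mul1r ?mul0r.
  by rewrite hornerC.
Qed.

(* After subtracting an inner derivation, the corner entry [D] vanishes on all
   vertices and loops, hence it is nonzero on some arrow [a_m]; this forces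
   [m = j] and [m + 1 = l], and the relation at [m] does the rest. *)
Lemma nonsplit_extension q (F : elt K n -> 'M[K]_2) j l f0 :
  quot_hom q F -> (forall f, F f 1 0 = 0) -> j != l ->
  (forall m, F (vtx m) 0 0 = (m == j)%:R) ->
  (forall m, F (vtx m) 1 1 = (m == l)%:R) ->
  fin_supp f0 -> F f0 0 0 = 0 -> F f0 1 1 = 0 -> F f0 0 1 != 0 ->
  F (arr (arr_b j)) 0 0 = q j * F (arr (arr_b l)) 1 1.
Proof.
move=> hF F10 jl Fv0 Fv1 sf0 f00 f01 nz; have [[lF mF _] _] := hF.
pose c := F (vtx j) 0 1.
pose D f : K^o := F f 0 1 - c * (F f 0 0 - F f 1 1).
(* [D] is a derivation with respect to the two diagonal characters; the choice of [c] makes it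
   vanish on [e_j]. *)
have DM f g : fin_supp f -> fin_supp g ->
    D (emul f g) = F f 0 0 * D g + D f * F g 1 1.
  move=> sf sg; rewrite /D mF // !mul_mx2 !F10 !(mulr0, mul0r, addr0, add0r).
  by ring.
have lD : linear_map D.
  by move=> a f g sf sg; rewrite /D lF // !mxE /GRing.scale /=; ring.
have Dv m : D (vtx m) = 0.
  have Dj : D (vtx j) = 0 by rewrite /D Fv0 Fv1 eqxx (negbTE jl) subr0 mulr1 subrr.
  have [->//|ne] := eqVneq m j.
  (* The product of [e_j] and [e_m] is 0, and the derivation rule reduces its image to
     [D (vtx m)]. *)
  have := DM (vtx j) (vtx m) (fin_supp_vtx _) (fin_supp_vtx _).
  rewrite emul_path_vertex // /endv /= eq_sym (negbTE ne) (linear_map0 lD).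
  by rewrite Dj Fv0 eqxx mul1r mul0r addr0.
have Dx (x : arrow n) : D (arr x) = (src x == j)%:R * D (arr x) * (tgt x == l)%:R.
  have sx := fin_supp_arr x.
  have -> : (src x == j)%:R * D (arr x) = D (arr x).
    have := DM (vtx (src x)) (arr x) (fin_supp_vtx _) sx.
    by rewrite emul_src_arr Dv mul0r addr0 Fv0.
  have := DM (arr x) (vtx (tgt x)) sx (fin_supp_vtx _).
  by rewrite emul_arr_tgt Dv mulr0 add0r Fv1.
have Db m : D (arr (arr_b m)) = 0.
  rewrite Dx /tgt /src /=; case: (m =P j) => [->|_]; last by rewrite !mul0r.
  by rewrite (negbTE jl) mulr0.
have [m Dm] : exists m, D (arr (arr_a m)) != 0.
  apply/existsP; rewrite -negb_forall; apply/negP => /forallP Da.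
  (* Vanishing on all arrows would propagate to all paths, but [D f0] is the nonzero corner of
     [F f0]. *)
  suff D0 : D f0 = 0 by move: D0; rewrite /D f00 f01 subrr mulr0 subr0 => /eqP; apply/negP.
  rewrite (linear_map_ext (G := fun=> 0 : K^o) lD _ _ sf0) //.
    by move=> a f g _ _; rewrite scaler0 addr0.
  move=> [i s]; rewrite /valid /=; elim: s i => [|x s IH] i /=; first by rewrite Dv.
  move=> /andP[/eqP <- v]; rewrite -emul_arrow_path // DM; last 2 first.
  - exact: fin_supp_arr x.
  - exact: fin_supp_delta.
  rewrite IH // mulr0 add0r; case: x v => [[] m] v; last by rewrite (eqP (Da m)) mul0r.
  by rewrite (Db m) mul0r.
have [mj ml] : m = j /\ ordS m = l.
  move: Dm; rewrite Dx /src /tgt /=.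
  case: (m =P j) => [->|_]; last by rewrite !mul0r eqxx.
  by case: (ordS j =P l) => [->//|_]; rewrite mulr0 eqxx.
have sb i := fin_supp_arr (arr_b i).
have sa := fin_supp_arr (arr_a m).
have e1 : delta (m, [:: arr_b m; arr_a m]) = emul (arr (arr_b m)) (arr (arr_a m)).
  exact/esym/emul_arrow_path/(valid_arr (arr_a m)).
have e2 : delta (m, [:: arr_a m; arr_b l]) = emul (arr (arr_a m)) (arr (arr_b l)).
  rewrite -ml; exact/esym/emul_arrow_path/(valid_arr (arr_b (ordS m))).
have := quot_hom_rel m hF; rewrite ml => rel.
(* As [D] kills loops, both sides are multiples of [D (arr (arr_a m))], which cancels. *)
have : D (delta (m, [:: arr_b m; arr_a m])) = q m * D (delta (m, [:: arr_a m; arr_b l])).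
  by rewrite /D rel !mxE; ring.
rewrite e1 e2 !DM // !Db !(mulr0, mul0r, addr0, add0r) [F _ 0 0 * _]mulrC mulrCA.
by move=> /(mulfI Dm); rewrite mj.
Qed.

(** * Invariance of the product of the parameters *)

Lemma size2_horner (g : {poly K}) c : size g = 2%N -> g.[c] = g`_0 + g`_1 * c.
Proof.
move=> sg; rewrite horner_coef sg !big_ord_recl big_ord0 /=.
by rewrite expr0 expr1 mulr1 addr0.
Qed.

Lemma B_iso_prod q p : B_iso q p -> \prod_i p i = \prod_i q i.
Proof.
case=> phi [psi [sphi [spsi [cphi [_ [lphi [mphi [ophi [_ phiK]]]]]]]]].
(* [phi] is multiplicative and linear only modulo the ideal of [p], which [F] does not see. *)
have pull (A : algType K) (F : elt K n -> A) : quot_hom p F -> quot_hom q (F \o phi).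
  move=> hF; have [[lF mF oF] bF] := hF.
  have lFp : linear_map (F \o phi).
    move=> c f g sf sg /=; rewrite (quot_hom_cong hF _ _ (lphi c f g sf sg)).
    - by apply: lF; apply: sphi.
    - by apply/sphi/fin_supp_lin.
    - by apply: fin_supp_lin; apply: sphi.
  split; first split => // [f g sf sg|] /=.
  - rewrite (quot_hom_cong hF _ _ (mphi f g sf sg)).
    + by apply: mF; apply: sphi.
    + by apply/sphi/fin_supp_emul.
    + by apply: fin_supp_emul; apply: sphi.
  - rewrite (quot_hom_cong hF _ _ ophi) //; [apply: sphi|]; exact: fin_supp_eone.
  - move=> i; rewrite -(linear_map0 lFp) /=; apply: (quot_hom_cong hF).
    + exact/sphi/fin_supp_brel.
    + exact/sphi/fin_supp0.
    + by apply: cphi; [exact: fin_supp_brel|exact: fin_supp0|exact: brel_cong0].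
have surj (A : algType K) (F : elt K n -> A) g : quot_hom p F -> fin_supp g ->
    F (phi (psi g)) = F g.
  move=> hF sg; apply: (quot_hom_cong hF) => //; last exact: phiK.
  exact/sphi/spsi.
have [|sg sgE] := @fin_all_exists 'I_n (fun=> ('I_n * {poly K})%type) (fun i sg =>
    forall f, fin_supp f -> line_char i (phi f) = line_char sg.1 f \Po sg.2).
  move=> i; have [hX _] := pull _ _ (line_char_hom p i).
  by have [j [g H]] := line_char_classification hX; exists (j, g).
pose s i := (sg i).1; pose g i := (sg i).2.
have sgE' i f : fin_supp f -> line_char i (phi f) = line_char (s i) f \Po g i.
  exact: sgE.
have lift_back i f : fin_supp f -> line_char (s i) (psi f) \Po g i = line_char i f.
  move=> sf; rewrite -sgE'; last exact: spsi.
  exact: surj (line_char_hom p i) sf.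
(* Lifting [b_i] back through [psi] writes ['X] as a composite with [g i]; degrees multiply, so
   [g i] has degree one. *)
have size_g i : size (g i) = 2%N.
  have := lift_back i _ (fin_supp_arr (arr_b i)).
  rewrite line_char_arrow /= eqxx => /(congr1 (fun r : {poly K} => (size r).-1)).
  rewrite size_comp_poly size_polyX /= => /eqP; rewrite muln_eq1 => /andP[_].
  by case: (size (g i)) => [|[|[|]]].
(* If [s i = s k] with [i] and [k] distinct, lifting [e_k] gives a polynomial whose composite with
   the nonconstant [g i] is 0 but with [g k] is 1. *)
have s_inj : injective s.
  move=> i k sik; apply/eqP; apply: contraT => ik.
  have := lift_back i _ (fin_supp_vtx k).
  have := lift_back k _ (fin_supp_vtx k).
  rewrite -sik !line_char_vertex eqxx eq_sym (negbTE ik) => e1 /eqP.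
  rewrite comp_poly_eq0 ?size_g // => /eqP z; move: e1; rewrite z comp_poly0.
  by move/esym/eqP; rewrite oner_eq0.
have rel t i : (g i).[p i * t] = q (s i) * (g (ordS i)).[t].
  pose F := tri_rep (p i) t i \o phi.
  have F0 f : fin_supp f -> F f 0 0 = (line_char (s i) f).[(g i).[p i * t]].
    by move=> sf; rewrite /F /= tri_rep_diag0 ?sgE' ?horner_comp //; apply: sphi.
  have F1 f : fin_supp f -> F f 1 1 = (line_char (s (ordS i)) f).[(g (ordS i)).[t]].
    by move=> sf; rewrite /F /= tri_rep_diag1 ?sgE' ?horner_comp //; apply: sphi.
  have hT := tri_rep_hom p t i.
  have Fa : F (psi (arr (arr_a i))) = tri 0 1 0.
    have -> : F (psi (arr (arr_a i))) = tri_rep (p i) t i (arr (arr_a i)).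
      exact: surj hT (fin_supp_arr _).
    by rewrite tri_rep_arrow /tri_arrow /= eqxx.
  have Fb0 : F (arr (arr_b (s i))) 0 0 = (g i).[p i * t].
    by rewrite (F0 _ (fin_supp_arr _)) line_char_arrow /= eqxx hornerX.
  have Fb1 : F (arr (arr_b (s (ordS i)))) 1 1 = (g (ordS i)).[t].
    by rewrite (F1 _ (fin_supp_arr _)) line_char_arrow /= eqxx hornerX.
  rewrite -Fb0 -Fb1.
  (* The lift of [a_i] maps to the upper corner matrix unit, which witnesses that the pulled-back
     extension does not split. *)
  apply: (nonsplit_extension (f0 := psi (arr (arr_a i))) (pull _ _ hT)).
  - by move=> f; apply: tri_rep_lower.
  - by rewrite (inj_eq s_inj) eq_sym ordS_neq.
  - move=> m; rewrite F0 ?line_char_vertex; last exact: fin_supp_vtx.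
    by case: eqP; rewrite hornerC.
  - move=> m; rewrite F1 ?line_char_vertex; last exact: fin_supp_vtx.
    by case: eqP; rewrite hornerC.
  - exact/spsi/fin_supp_arr.
  - by rewrite -/F Fa mxE.
  - by rewrite -/F Fa mxE.
  - by rewrite -/F Fa mxE /= oner_neq0.
have coef_rel i : p i * (g i)`_1 = q (s i) * (g (ordS i))`_1.
  (* The value at 0 matches the constant terms; subtracting it from the value at 1 leaves the linear
     ones. *)
  have := rel 1 i; have := rel 0 i; rewrite !size2_horner // !(mulr0, mulr1, addr0).
  by move=> -> ; rewrite mulrDr => /addrI <-; rewrite mulrC.
have g_neq0 : \prod_i (g i)`_1 != 0.
  apply/prodf_neq0 => i _; have := lead_coef_eq0 (g i); rewrite lead_coefE size_g /= => ->.
  by rewrite -size_poly_eq0 size_g.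
(* Since [s] and [ordS] permute the indices, the product of the linear coefficients appears on both
   sides and cancels. *)
apply: (mulIf g_neq0); rewrite -big_split /=; under eq_bigr => i _ do rewrite coef_rel.
rewrite big_split /=; congr (_ * _); first by rewrite [RHS](reindex_inj s_inj).
by rewrite [RHS](reindex_inj (can_inj (@ordSK n))).
Qed.

End Representations.

Theorem theorem2p10 (K : closedFieldType) (Hchar : [pchar K] =i pred0)
  (n : nat) (Hn : (2 <= n)%N) (q p : 'I_n -> K)
  (Hq : forall i, q i != 0) (Hp : forall i, p i != 0) :
  B_iso q p <->
  exists alpha : 'I_n -> K, (forall i, alpha i != 0) /\
    exists k : 'I_n, forall i : 'I_n,
      p i = alpha (ordS (shift k i)) / alpha (shift k i) * q (shift k i).
Proof.
split=> [/(B_iso_prod Hn)|[a [a0 [k pE]]]].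
  move=> /(prod_eq_telescope Hq Hp)[a a0 pE]; exists a; split => //.
  (* The witness for the shift is 0. *)
  by exists (Ordinal (ltnW Hn)).
(* Passing through the products trades the shifted rescaling for an unshifted one, which [twist]
   realises. *)
have [b b0 pE'] := prod_eq_telescope Hq Hp (prod_shift_twist a0 pE).
exact: B_iso_twist b0 pE'.
Qed.
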